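(* Let $U:\mathbb{Z}\to\mathbb{Q}$ be a linear recurrence sequence, let $a\in\mathbb{Z}$, and let $p$ be a regular prime for $U$. Assume that there exists a sequence of integers $(n_k)$ such that $\nu_p(U(n_k))\to+\infty$ and $\nu_p(n_k-a)\to+\infty$. Then $a$ is a twisted zero of $U$.
   Context: A $\mathbb{Q}$-valued linear recurrence sequence (LRS) is a map $U:\mathbb{Z}\to\mathbb{Q}$ with $U(n+m)=a_{m-1}U(n+m-1)+\dots+a_0U(n)$ for all $n\in\mathbb{Z}$, with $a_i\in\mathbb{Q}$, $a_0\ne0$, $m$ minimal. Let $\lambda_1,\dots,\lambda_s\in\overline{\mathbb{Q}}$ be the distinct roots of $X^m-a_{m-1}X^{m-1}-\dots-a_0$; then $U(n)=f_1(n)\lambda_1^n+\dots+f_s(n)\lambda_s^n$ for all $n\in\mathbb{Z}$ with nonzero polynomials $f_i$ over $\mathbb{Q}(\lambda_1,\dots,\lambda_s)$ (Binet expansion). An integer $a$ is a twisted zero of $U$ if there are roots of unity $\xi_1,\dots,\xi_s$ with $\xi_1f_1(a)\lambda_1^a+\dots+\xi_sf_s(a)\lambda_s^a=0$. A prime $p$ is regular for $U$ if $p$ divides neither the denominators of $a_0,\dots,a_{m-1}$ nor the numerator of $a_0$. $\nu_p$ is the $p$-adic valuation, $\nu_p(0)=+\infty$. *)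

(* Defs.v *)
From mathcomp Require Import all_boot all_order all_algebra all_field.
From mathcomp Require Import constructive_ereal.

Set Implicit Arguments.
Unset Strict Implicit.
Unset Printing Implicit Defensive.

Import Order.TTheory GRing.Theory Num.Theory.

Local Open Scope ring_scope.

(* The list c = [:: a_0; ...; a_(m-1)] stands for the recurrence
     U(n+m) = a_(m-1) U(n+m-1) + ... + a_0 U(n)   for all n,
   with a_0 != 0.  The order m = 0 is allowed, so that the zero sequence has the
   minimal recurrence [::], no characteristic roots, and the empty sum as Binet
   expansion; the default 1 in [lowest_coef c] then makes the conditions on a_0 void. *)
Definition lowest_coef (c : seq rat) : rat := head 1 c.

Definition recurrence (U : int -> rat) (c : seq rat) : Prop :=
  lowest_coef c != 0 /\
  forall n : int,
    U (n + (size c)%:Z) = \sum_(i < size c) c`_i * U (n + (i : nat)%:Z).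

Definition minimal_recurrence (U : int -> rat) (c : seq rat) : Prop :=
  recurrence U c /\
  forall c' : seq rat, recurrence U c' -> (size c <= size c')%N.

Record lrs := Lrs {
  lrs_fun :> int -> rat;
  lrs_coefs : seq rat;
  lrs_minimal : minimal_recurrence lrs_fun lrs_coefs }.

Definition char_poly_lrs (U : lrs) : {poly rat} :=
  'X^(size (lrs_coefs U)) - Poly (lrs_coefs U).

(* Membership in Q(lam_1, ..., lam_s): a [divring_closed] predicate on algC is a
   subfield, since 0^-1 = 0. *)
Definition in_adjoin (s : nat) (lam : 'I_s -> algC) (x : algC) : Prop :=
  forall S : {pred algC},
    GRing.divring_closed S -> (forall i, lam i \in S) -> x \in S.

Definition binet_expansion (U : lrs) (s : nat) (lam : 'I_s -> algC)
    (f : 'I_s -> {poly algC}) : Prop :=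
  [/\ injective lam,
      forall x : algC,
        root (map_poly ratr (char_poly_lrs U)) x <-> exists i, lam i = x,
      forall i, f i != 0,
      forall i (k : nat), in_adjoin lam (f i)`_k
    & forall n : int,
        ratr (U n) = \sum_(i < s) (f i).[n%:~R] * lam i ^ n].

Definition is_root_of_unity (x : algC) : Prop :=
  exists2 n : nat, (0 < n)%N & n.-unity_root x.

Definition twisted_zero (U : lrs) (a : int) : Prop :=
  exists (s : nat) (lam : 'I_s -> algC) (f : 'I_s -> {poly algC}),
    binet_expansion U lam f /\
    exists xi : 'I_s -> algC,
      (forall i, is_root_of_unity (xi i)) /\
      \sum_(i < s) xi i * (f i).[a%:~R] * lam i ^ a = 0.

Definition regular_prime (U : lrs) (p : nat) : Prop :=
  [/\ prime p,
      forall x : rat, x \in lrs_coefs U -> ~~ (p %| `|denq x|)%N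
    & ~~ (p %| `|numq (lowest_coef (lrs_coefs U))|)%N].

Definition padic_val (p : nat) (x : rat) : \bar int :=
  if x == 0 then +oo%E
  else ((logn p `|numq x|)%:Z - (logn p `|denq x|)%:Z)%:E.

Definition tends_to_pinfty (v : nat -> \bar int) : Prop :=
  forall M : int, exists K : nat, forall k : nat, (K <= k)%N -> (M%:E <= v k)%E.

(* Main.v *)
(* For each n = a + p^t k, the numbers mu_i = lam_i^(n - a) satisfy
   mu_i^N = 1 modulo p^t, where N is a common period of the powers of the roots
   modulo p (it exists because the roots are units at p and the residue ring is
   finite).  So, with y_i = f_i(a) lam_i^a, U(n) is congruent to the sum of the
   mu_i y_i modulo p^(t - C), and eliminating the mu_i shows that the product of
   the sums of the xi_i y_i over all tuples of N-th roots of unity is highly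
   divisible by p.  This product does not depend on n, hence it is 0.  No place
   above p has to be chosen.
   The Binet expansion comes from solving (E - lam_j)...(E - lam_1) U = 0 one
   factor at a time, E being the shift.  If some f_i were 0, a monic polynomial
   in E of degree < m over the splitting field would kill U, and applying to its
   coefficients a Q-linear functional that fixes 1 would contradict the
   minimality of m. *)

Require Import Defs.
From mathcomp Require Import all_boot all_order all_algebra all_field.
From mathcomp Require Import constructive_ereal ring.

Set Implicit Arguments.
Unset Strict Implicit.

Import Order.TTheory GRing.Theory Num.Theory.

Local Open Scope ring_scope.

(** * Divisibility by powers of [p] among algebraic numbers *)

(* [x] lies in [p^t O], where [O] is the ring of algebraic numbers that become
   algebraic integers after multiplication by an integer prime to [p]. *)
Definition pdvd (p t : nat) (x : algC) : Prop :=
  exists m : nat, exists2 z : algC,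
    coprime p m && (z \in Aint) & m%:R * x = p%:R ^+ t * z.

Lemma Aint_nat (n : nat) : n%:R \in Aint.
Proof. exact: Aint_int n. Qed.

Lemma pdvd_Aint (p : nat) (x : algC) : x \in Aint -> pdvd p 0 x.
Proof. by move=> xA; exists 1%N, x; rewrite ?coprimen1 ?mul1r. Qed.

Lemma pdvd_zero (p t : nat) : pdvd p t 0.
Proof. by exists 1%N, 0; rewrite ?coprimen1 ?Aint0 ?mulr0. Qed.

Lemma pdvdN (p t : nat) (x : algC) : pdvd p t x -> pdvd p t (- x).
Proof.
case=> m [z /andP[cm zA] e]; exists m, (- z); first by rewrite cm rpredN.
by rewrite !mulrN e.
Qed.

Lemma pdvdD (p t : nat) (x y : algC) :
  pdvd p t x -> pdvd p t y -> pdvd p t (x + y).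
Proof.
move=> [m [z /andP[cm zA] e]] [m' [z' /andP[cm' zA'] e']].
exists (m * m')%N, (m'%:R * z + m%:R * z').
  by rewrite coprimeMr cm cm' rpredD // rpredM ?Aint_nat.
rewrite natrM mulrDr [p%:R ^+ t * _]mulrDr ![p%:R ^+ t * _]mulrCA -e -e'.
by ring.
Qed.

Lemma pdvdB (p t : nat) (x y : algC) :
  pdvd p t x -> pdvd p t y -> pdvd p t (x - y).
Proof. by move=> dx dy; apply/pdvdD/pdvdN. Qed.

Lemma pdvd_mul (p s t : nat) (x y : algC) :
  pdvd p s x -> pdvd p t y -> pdvd p (s + t) (x * y).
Proof.
move=> [m [z /andP[cm zA] e]] [m' [z' /andP[cm' zA'] e']].
exists (m * m')%N, (z * z'); first by rewrite coprimeMr cm cm' rpredM.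
by rewrite natrM mulrACA e e' exprD mulrACA.
Qed.

Lemma pdvdMl (p t : nat) (x y : algC) :
  pdvd p 0 x -> pdvd p t y -> pdvd p t (x * y).
Proof. exact: pdvd_mul. Qed.

Lemma pdvdMr (p t : nat) (x y : algC) :
  pdvd p t x -> pdvd p 0 y -> pdvd p t (x * y).
Proof. by rewrite mulrC => dx dy; apply: pdvdMl. Qed.

Lemma pdvd_expn (p t : nat) : pdvd p t (p%:R ^+ t).
Proof. by exists 1%N, 1; rewrite ?coprimen1 ?Aint1 ?mulr1 ?mul1r. Qed.

Lemma pdvdW (p s t : nat) (x : algC) : (s <= t)%N -> pdvd p t x -> pdvd p s x.
Proof.
move=> st [m [z /andP[cm zA] e]]; exists m, (p%:R ^+ (t - s) * z).
  by rewrite cm rpredM // rpredX ?Aint_nat.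
by rewrite e mulrA -exprD subnKC.
Qed.

Lemma pdvd_sum (p t : nat) (I : Type) (r : seq I) (P : pred I) (F : I -> algC) :
  (forall i, P i -> pdvd p t (F i)) -> pdvd p t (\sum_(i <- r | P i) F i).
Proof.
by move=> dF; elim/big_ind: _ => //; [exact: pdvd_zero | exact: pdvdD].
Qed.

Lemma pdvd_one (p : nat) : pdvd p 0 1.
Proof. by apply: pdvd_Aint; exact: Aint1. Qed.

Lemma pdvd_prod (p : nat) (I : Type) (r : seq I) (P : pred I) (F : I -> algC) :
  (forall i, P i -> pdvd p 0 (F i)) -> pdvd p 0 (\prod_(i <- r | P i) F i).
Proof.
by move=> dF; elim/big_ind: _ => //; [exact: pdvd_one | exact: pdvdMl].
Qed.

Lemma pdvdX (p n : nat) (x : algC) : pdvd p 0 x -> pdvd p 0 (x ^+ n).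
Proof.
move=> dx; elim: n => [|n IHn]; first exact: pdvd_one.
by rewrite exprS; apply: pdvdMl.
Qed.

Lemma pdvd_subX (p t k : nat) (x y : algC) :
  pdvd p 0 x -> pdvd p 0 y -> pdvd p t (x - y) -> pdvd p t (x ^+ k - y ^+ k).
Proof.
move=> dx dy dxy; rewrite subrXX; apply: pdvdMr => //.
by apply: pdvd_sum => i _; apply: pdvdMl; apply: pdvdX.
Qed.

(** If [u] is congruent to 1 modulo [p], then [1 + u + ... + u^(p-1)] is congruent to [p], hence to
    0, so each [p]-th power gains one factor [p] in [u - 1]. Starting from exponent 1, the induction
    reaches [t.+1]. *)
Lemma pdvd_sub_expp (p t : nat) (x : algC) :
  pdvd p 0 x -> pdvd p 1 (x - 1) -> pdvd p t (x ^+ (p ^ t) - 1).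
Proof.
move=> dx dx1; suff: pdvd p t.+1 (x ^+ (p ^ t) - 1) by apply: pdvdW.
elim: t => [|t IHt]; first by rewrite expn0 expr1.
rewrite expnSr exprM subrX1 -addn1; apply: pdvd_mul => //.
set u := x ^+ _ in IHt *.
have -> : \sum_(i < p) u ^+ i = \sum_(i < p) (u ^+ i - 1) + p%:R.
  by rewrite sumrB sumr_const card_ord subrK.
apply: pdvdD; last by rewrite -[p%:R]expr1; apply: pdvd_expn.
have du : pdvd p 1 (u - 1) by apply: pdvdW IHt.
apply: pdvd_sum => i _; rewrite -[1 in X in pdvd _ _ X](expr1n _ i).
by apply: pdvd_subX => //; [apply: pdvdX | apply: pdvd_one].
Qed.

Lemma pdvd_rat (p t : nat) (x : rat) :
  coprime p `|denq x|%N -> (p ^ t %| `|numq x|)%N -> pdvd p t (ratr x).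
Proof.
move=> cx /dvdnP[q eq]; exists `|denq x|%N, ((-1) ^+ (numq x < 0)%R * q%:R).
  by rewrite cx rpredM ?rpredX ?rpredN ?Aint1 ?Aint_nat.
have -> : (`|denq x|%N)%:R = (denq x)%:~R :> algC.
  by rewrite -[in RHS](gez0_abs (denq_ge0 x)) -pmulrn.
rewrite [ratr x]/ratr mulrCA divff ?intr_eq0 ?denq_neq0 // mulr1.
rewrite [numq x in LHS]intEsign eq rmorphM rmorphXn rmorphN1 /=.
by rewrite -pmulrn natrM natrX; ring.
Qed.

(** The cofactor [z] is rational and an algebraic integer, hence an integer. Since [m] is prime to
    [p], Gauss's lemma leaves all of [p ^ t] in the numerator. *)
Lemma pdvd_numq (p t : nat) (x : rat) :
  prime p -> pdvd p t (ratr x) -> (p ^ t %| `|numq x|)%N.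
Proof.
move=> pr_p [m [z /andP[cm zA] e]].
have m0 : m%:R != 0 :> algC.
  rewrite pnatr_eq0; apply: contraTneq cm => ->.
  by rewrite prime_coprime ?dvdn0.
have p0 : p != 0%N by rewrite -lt0n prime_gt0.
have : z \in Num.int.
  apply: Cint_rat_Aint zA.
  have -> : z = m%:R * ratr x / p%:R ^+ t.
    by rewrite e mulrAC divff ?mul1r // expf_neq0 // pnatr_eq0.
  move: (ratr x) (Crat_rat x) => y yC.
  by rewrite rpred_div ?rpredM ?rpredX ?rpred_nat.
case/intrP=> k ek; rewrite {}ek in e.
have: (m%:Z * numq x = p%:Z ^+ t * k * denq x)%R.
  apply: (@intr_inj algC); rewrite !rmorphM rmorphXn /= -e.
  by rewrite /ratr -!pmulrn !mulrA divfK ?intr_eq0 ?denq_neq0.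
move/(congr1 absz); rewrite !abszM abszX /= => e2.
rewrite -(@Gauss_dvdr _ m) ?coprimeXl //.
by rewrite e2 -mulnA dvdn_mulr.
Qed.

(** * Denominators, and numbers divisible by all powers of [p] *)

(** Multiplying [q(y) = 0] by [d^m], with [m] the degree of [q], gives a monic equation for [d y]
    with the integral coefficients [d^(m-i) q_i]. *)
Lemma Aint_scale (q : {poly rat}) (d : nat) (y : algC) :
  q \is monic -> root (map_poly ratr q) y ->
  (forall i, (d%:R * q`_i : rat) \is a Num.int) -> d%:R * y \in Aint.
Proof.
move=> mq /rootP qy0 dq; set m := (size q).-1.
have sq : size q = m.+1 by rewrite prednK // size_poly_gt0 monic_neq0.
have lq : q`_m = 1 by apply/monicP: mq.
pose P : {poly algC} := \poly_(i < m.+1) (d%:R ^+ (m - i) * ratr q`_i).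
have sP : size P = m.+1.
  by apply: size_poly_eq; rewrite subnn lq rmorph1 mulr1 oner_neq0.
apply: (@root_monic_Aint P); first last.
- apply/polyOverP => i; rewrite coef_poly; case: ltnP => im; last exact: rpred0.
  have [->|ne_im] := eqVneq i m; first by rewrite subnn lq rmorph1 mulr1 rpred1.
  have -> : (m - i = (m - i).-1.+1)%N.
    by rewrite prednK // subn_gt0 ltn_neqAle ne_im -ltnS.
  rewrite exprSr -mulrA rpredM ?rpredX ?rpred_nat //.
  have -> : d%:R * ratr q`_i = ratr (d%:R * q`_i) :> algC.
    by rewrite rmorphM rmorph_nat.
  by have /intrP[k ->] := dq i; rewrite ratr_int rpred_int.
- by rewrite monicE lead_coefE sP coef_poly leqnn subnn lq rmorph1 mulr1.
apply/rootP; transitivity (d%:R ^+ m * (map_poly ratr q).[y]); last first.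
  by rewrite qy0 mulr0.
rewrite horner_poly horner_coef size_map_poly sq mulr_sumr; apply: eq_bigr => i _.
have im : (i <= m)%N by rewrite -ltnS.
have -> : d%:R ^+ m = d%:R ^+ (m - i) * d%:R ^+ i :> algC.
  by rewrite -exprD subnK.
by rewrite coef_map exprMn /=; ring.
Qed.

Lemma rat_common_denom (q : {poly rat}) :
  exists d : nat, [/\ (0 < d)%N, forall i, (d%:R * q`_i : rat) \is a Num.int
    & forall p, (forall i, coprime p `|denq q`_i|) -> coprime p d].
Proof.
exists (\prod_(i < size q) `|denq q`_i|)%N; split.
- by rewrite prodn_gt0 // => i; rewrite absz_gt0 denq_neq0.
- move=> i; case: (ltnP i (size q)) => [iq|/(nth_default 0) ->]; last first.
    by rewrite mulr0 rpred0.
  rewrite (bigD1 (Ordinal iq)) //= natrM mulrAC rpredM ?rpred_nat //.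
  have -> : (`|denq q`_i|%N)%:R = (denq q`_i)%:~R :> rat.
    by rewrite -[in RHS](gez0_abs (denq_ge0 _)) -pmulrn.
  rewrite -[X in _ * X]divq_num_den mulrCA divff ?intr_eq0 ?denq_neq0 //.
  by rewrite mulr1 rpred_int.
- move=> p cop; elim/big_ind: _ => [|a b ca cb|i _]; first exact: coprimen1.
    by rewrite coprimeMr ca.
  exact: cop.
Qed.

Lemma algC_denom (y : algC) : exists2 d : nat, (0 < d)%N & d%:R * y \in Aint.
Proof.
have [q [qy mq _]] := minCpolyP y; have [d [d0 dq _]] := rat_common_denom q.
by exists d => //; apply: Aint_scale mq _ dq; rewrite -qy root_minCpoly.
Qed.

Lemma algC_seq_denom (s : seq algC) :
  exists2 d : nat, (0 < d)%N & {in s, forall y, d%:R * y \in Aint}.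
Proof.
elim: s => [|y s [d d0 ds]]; first by exists 1%N.
have [e e0 ey] := algC_denom y; exists (d * e)%N; first by rewrite muln_gt0 d0.
move=> z; rewrite natrM inE => /orP[/eqP->|/ds zs].
  by rewrite -mulrA rpredM ?Aint_nat.
by rewrite mulrAC mulrC rpredM ?Aint_nat.
Qed.

(** This form serves two purposes: divisibility of [x] by powers of [p] passes to the constant term,
    and an invertible constant term makes [x] invertible. *)
Lemma root_const_coef (q : {poly rat}) (x : algC) :
  root (map_poly ratr q) x ->
  ratr q`_0 = - (\sum_(i < (size q).-1) ratr q`_i.+1 * x ^+ i) * x.
Proof.
case: (posnP (size q)) => [|sq /rootP].
  move=> /eqP; rewrite size_poly_eq0 => /eqP-> _.
  by rewrite size_poly0 big_ord0 coef0 rmorph0 oppr0 mul0r.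
rewrite horner_coef size_map_poly; case: (size q) sq => //= m _; rewrite big_ord_recl.
rewrite expr0 mulr1 coef_map => /eqP; rewrite addr_eq0 => /eqP ->.
rewrite mulNr mulr_suml; congr (- _); apply: eq_bigr => i _.
by rewrite coef_map exprSr mulrA.
Qed.

(** Up to denominators, a nonzero [x] divides the constant term of its minimal polynomial. That
    nonzero rational would then be divisible by every power of [p]. *)
Lemma pdvd_eq0 (p : nat) (x : algC) :
  prime p -> (forall t, pdvd p t x) -> x = 0.
Proof.
move=> pr_p dx; apply/eqP; apply: contraT => x0.
have [q [qx mq q_min]] := minCpolyP x; have q0 := monic_neq0 mq.
have rq : root (map_poly ratr q) x by rewrite -qx root_minCpoly.
(* Otherwise ['X] divides [q], and the quotient still vanishes at the nonzero [x], against
   minimality. *)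
have q00 : q`_0 != 0.
  apply: contraT => /negPn; rewrite -horner_coef0 => /factor_theorem[r].
  rewrite subr0 => eq_q; move: rq (q_min r).
  rewrite {1}eq_q rmorphM rootM /= map_polyX rootX (negPf x0) orbF => -> /esym.
  have r0 : r != 0 by apply: contraNneq q0 => r0; rewrite eq_q r0 mul0r.
  by move/(dvdp_leq r0); rewrite eq_q size_mulX // ltnn.
have [d [d0 dq _]] := rat_common_denom q.
have dq0 t : pdvd p t (ratr (d%:R * q`_0)).
  have -> : ratr (d%:R * q`_0) = d%:R * ratr q`_0 :> algC.
    by rewrite rmorphM rmorph_nat.
  rewrite (root_const_coef rq) mulNr mulrN mulrA.
  apply/pdvdN/pdvdMl => //; rewrite mulr_sumr; apply: pdvd_sum => i _.
  have -> : d%:R * (ratr q`_i.+1 * x ^+ i) = ratr (d%:R * q`_i.+1) * x ^+ i.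
    by rewrite rmorphM rmorph_nat mulrA.
  apply: pdvdMl; last by apply: pdvdX; apply: (dx 0%N).
  by have /intrP[k ->] := dq i.+1; rewrite ratr_int; apply/pdvd_Aint/Aint_int.
set n := `|numq (d%:R * q`_0)|%N.
have n0 : (0 < n)%N.
  by rewrite absz_gt0 numq_eq0 mulf_neq0 // pnatr_eq0 -lt0n.
have /dvdn_leq := pdvd_numq pr_p (dq0 n); move/(_ n0).
by rewrite leqNgt ltn_expl ?prime_gt1.
Qed.

Lemma pdvd_ratV (p : nat) (x : rat) :
  x != 0 -> coprime p `|numq x| -> pdvd p 0 (ratr x^-1).
Proof.
move=> x0 cx; exists `|numq x|%N, ((-1) ^+ (numq x < 0)%R * (denq x)%:~R).
  by rewrite cx rpredM ?rpredX ?rpredN ?Aint1 ?Aint_int.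
have -> : ratr x^-1 = (denq x)%:~R / (numq x)%:~R :> algC.
  by rewrite fmorphV /= /ratr invf_div.
have a0 : (`|numq x|%N)%:R != 0 :> algC.
  by rewrite pnatr_eq0 absz_eq0 numq_eq0.
rewrite -[X in _ / X%:~R]mulz_sign_abs rmorphM rmorphXn rmorphN1 /= -pmulrn.
by rewrite invfM invr_sign; field.
Qed.

(** * The characteristic roots at [p] *)

Lemma pdvd_root (p : nat) (q : {poly rat}) (x : algC) :
  (forall i, coprime p `|denq q`_i|) -> q \is monic ->
  root (map_poly ratr q) x -> pdvd p 0 x.
Proof.
move=> cop mq rq; have [d [_ dq /(_ p cop) cd]] := rat_common_denom q.
exists d, (d%:R * x); last by rewrite expr0 mul1r.
by rewrite cd (Aint_scale mq).
Qed.

Lemma pdvd_root_inv (p : nat) (q : {poly rat}) (x : algC) :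
  prime p -> (forall i, coprime p `|denq q`_i|) -> coprime p `|numq q`_0| ->
  q \is monic -> root (map_poly ratr q) x -> x != 0 /\ pdvd p 0 x^-1.
Proof.
move=> pr_p cop cq0 mq rq; have dx := pdvd_root cop mq rq.
have q00 : q`_0 != 0.
  rewrite -numq_eq0 -absz_eq0; apply: contraTneq cq0 => ->.
  by rewrite prime_coprime ?dvdn0.
have e := root_const_coef rq; set S := \sum_(i < _) _ in e.
have x0 : x != 0.
  apply: contra_neq q00 => x0; move: e; rewrite x0 mulr0 => /eqP.
  by rewrite fmorph_eq0 => /eqP.
split=> //.
have -> : x^-1 = - S * ratr (q`_0)^-1.
  have -> : ratr (q`_0)^-1 = (ratr q`_0)^-1 :> algC by rewrite fmorphV.
  rewrite e invfM mulrA divff ?mul1r //; apply: contra_neq q00 => S0.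
  by move: e; rewrite S0 mul0r => /eqP; rewrite fmorph_eq0 => /eqP.
apply: pdvdMr; last exact: pdvd_ratV.
apply/pdvdN/pdvd_sum => i _; apply: pdvdMl; last exact: pdvdX.
by apply: pdvd_rat; rewrite ?dvd1n.
Qed.

Lemma rat_mod_p (p : nat) (x : rat) :
  coprime p `|denq x| -> exists k : int, pdvd p 1 (ratr x - k%:~R).
Proof.
move=> cx; have /coprimezP[[u v] /= e] : coprimez (denq x) p.
  by rewrite coprimez_sym.
(* [u] inverts the denominator modulo [p]. *)
exists (numq x * u)%Z, `|denq x|%N, (v * numq x)%:~R; first by rewrite cx Aint_int.
have -> : (`|denq x|%N)%:R = (denq x)%:~R :> algC.
  by rewrite -[in RHS](gez0_abs (denq_ge0 x)) -pmulrn.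
rewrite mulrBr /ratr mulrCA divff ?intr_eq0 ?denq_neq0 // mulr1 expr1.
rewrite (pmulrn _ p) -!rmorphM -rmorphB /=; congr _%:~R.
transitivity (numq x * (u * denq x + v * p) - denq x * (numq x * u)).
  by rewrite e mulr1.
ring.
Qed.

(** A monic [Q] over the integers allows division of ['X^n] with integral remainder, and such
    remainders take finitely many values modulo [p]. *)
Lemma poly_mod_p (p : nat) (q : {poly rat}) :
  (forall i, coprime p `|denq q`_i|) -> q \is monic ->
  exists2 Q : {poly int}, Q \is monic /\ size Q = size q &
    forall x : algC, pdvd p 0 x -> root (map_poly ratr q) x ->
      pdvd p 1 (map_poly intr Q).[x].
Proof.
move=> cop mq; set m := (size q).-1.
have sq : size q = m.+1 by rewrite prednK // size_poly_gt0 monic_neq0.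
have lq : q`_m = 1 by apply/monicP: mq.
have /fin_all_exists[A dA] (i : 'I_m) := rat_mod_p (cop i).
(* The default 1 is the top coefficient: only the lower ones are replaced by residues, so [Q] is
   exactly monic. *)
pose B j := if insub j is Some i then A i else 1.
pose Q : {poly int} := \poly_(i < m.+1) B i.
have Bm : B m = 1 by rewrite /B insubN // ltnn.
have sQ : size Q = m.+1 by apply: size_poly_eq; rewrite Bm.
exists Q; first by rewrite monicE lead_coefE sQ coef_poly leqnn Bm sq.
move=> x dx /rootP qx0; rewrite -[_.[x]]subr0 -{}[X in _ - X]qx0.
rewrite !horner_coef size_map_poly sq size_map_inj_poly ?sQ //; last exact: intr_inj.
rewrite -sumrB; apply: pdvd_sum => i _; rewrite -mulrBl.
apply: pdvdMr; last exact: pdvdX.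
rewrite !coef_map coef_poly ltn_ord -opprB; apply: pdvdN; rewrite /B.
case: insubP => [j _ <-|]; first exact: dA.
rewrite -leqNgt => mi; have -> : i = m :> nat.
  by apply/eqP; rewrite eqn_leq mi -ltnS ltn_ord.
by rewrite lq /= rmorph1 subrr; apply: pdvd_zero.
Qed.

(** Pigeonhole on the remainders of ['X^n] by [Q] modulo [p]: two exponents agree at all roots
    simultaneously, and their difference is a common period. *)
Lemma root_period (p : nat) (q : {poly rat}) :
  prime p -> (forall i, coprime p `|denq q`_i|) -> coprime p `|numq q`_0| ->
  q \is monic ->
  exists2 N : nat, (0 < N)%N &
    forall x : algC, root (map_poly ratr q) x -> pdvd p 1 (x ^+ N - 1).
Proof.
move=> pr_p cop cq0 mq; have [Q [mQ sQ] dQ] := poly_mod_p cop mq.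
have p0 : p%:Z != 0 by rewrite -lt0n prime_gt0.
pose rem n : {poly int} := Pdiv.Ring.rmodp 'X^n Q.
have rem_eq n x : pdvd p 0 x -> root (map_poly ratr q) x ->
    pdvd p 1 (x ^+ n - (map_poly intr (rem n)).[x]).
  move=> dx rq; have := Pdiv.RingMonic.rdivp_eq mQ 'X^n.
  move/(congr1 (fun P : {poly int} => (map_poly intr P).[x])).
  rewrite rmorphD rmorphM /= map_polyXn hornerD hornerM hornerXn => ->.
  rewrite addrK; apply: pdvdMl; last exact: dQ.
  rewrite horner_coef; apply: pdvd_sum => i _; apply: pdvdMl; last exact: pdvdX.
  by rewrite coef_map; apply/pdvd_Aint/Aint_int.
(* [p.-1.+1] is [p], in the successor form that [inord] requires. *)
pose T : finType := {ffun 'I_(size q) -> 'I_p.-1.+1}.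
pose g n : T := [ffun j : 'I_(size q) => inord `|((rem n)`_j %% p)%Z|].
have g_eq n n' : g n = g n' ->
    forall x, pdvd p 0 x -> root (map_poly ratr q) x ->
    pdvd p 1 (x ^+ n - x ^+ n').
  move=> gnn' x dx rq.
  have : pdvd p 1 ((map_poly intr (rem n)).[x] - (map_poly intr (rem n')).[x]).
    rewrite -hornerN -hornerD -rmorphB /= horner_coef.
    rewrite size_map_inj_poly //; last exact: intr_inj.
    apply: pdvd_sum => i _.
    apply: pdvdMr; last exact: pdvdX.
    rewrite coef_map coefB /=; set a := _`_i; set b := _`_i.
    have /eqP : (a = b %[mod p])%Z.
      have iq : (i < size q)%N.
        apply: leq_trans (ltn_ord i) _; apply: leq_trans (size_polyD _ _) _.
        rewrite size_polyN geq_max -sQ.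
        by apply/andP; split; apply: ltnW;
          rewrite Pdiv.Ring.ltn_rmodpN0 ?monic_neq0.
      have lt_p (c : int) : (`|(c %% p)%Z| < p.-1.+1)%N.
        rewrite prednK ?prime_gt0 // -ltz_nat gez0_abs ?modz_ge0 //.
        by rewrite ltz_pmod // ltz_nat prime_gt0.
      move/ffunP/(_ (Ordinal iq))/(congr1 val): gnn'.
      rewrite !ffunE /= !inordK // => /(congr1 Posz).
      by rewrite !gez0_abs ?modz_ge0.
    rewrite eqz_mod_dvd => /dvdzP[k ->]; rewrite rmorphM /= mulrC -pmulrn.
    apply: pdvdMr; last exact/pdvd_Aint/Aint_int.
    by rewrite -[p%:R]expr1; exact: pdvd_expn.
  move=> d1; have d2 := pdvdB (rem_eq n x dx rq) (rem_eq n' x dx rq).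
  have := pdvdD d1 d2.
  by rewrite [X in pdvd _ _ X](_ : _ = x ^+ n - x ^+ n') //; ring.
have [n [n' lt_n g_nn']] : exists n, exists2 n', (n < n')%N & g n = g n'.
  pose h (i : 'I_(#|T|.+1)) : T := g i.
  have /injectivePn[i [j ij hij]] : ~~ injectiveb h.
    by apply/injectiveP => /leq_card; rewrite card_ord ltnn.
  case: (ltngtP i j) => [lt_ij|lt_ji|/val_inj eij].
  - by exists i, j.
  - by exists j, i.
  - by rewrite eij eqxx in ij.
exists (n' - n)%N; first by rewrite subn_gt0.
move=> x rq; have dx := pdvd_root cop mq rq.
have [x0 dxV] := pdvd_root_inv pr_p cop cq0 mq rq.
(* The common factor [x ^+ n] can be cancelled because [x] is a unit at [p]. *)
have -> : x ^+ (n' - n) - 1 = - ((x ^+ n - x ^+ n') * x^-1 ^+ n).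
  rewrite -[n' in RHS](subnK (ltnW lt_n)) exprD exprVn.
  by have := expf_neq0 n x0; move: (x ^+ n) (x ^+ (n' - n)) => y z y0; field.
by apply/pdvdN/pdvdMr; [apply: g_eq | apply: pdvdX].
Qed.

(** * Products over roots of unity *)

Lemma pdvd_prod_sub (p t : nat) (I : eqType) (r : seq I) (F G : I -> algC) :
  {in r, forall i, pdvd p 0 (F i)} -> {in r, forall i, pdvd p 0 (G i)} ->
  {in r, forall i, pdvd p t (F i - G i)} ->
  pdvd p t (\prod_(i <- r) F i - \prod_(i <- r) G i).
Proof.
elim: r => [|x r IHr] dF dG dFG.
  by rewrite !big_nil subrr; apply: pdvd_zero.
have sub_r i : i \in r -> i \in x :: r by rewrite inE orbC => ->.
rewrite !big_cons.
set P := \prod_(i <- r) F i in IHr *; set Q := \prod_(i <- r) G i in IHr *.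
have dP : pdvd p 0 P by rewrite /P big_seq; apply: pdvd_prod => i /sub_r/dF.
have -> : F x * P - G x * Q = (F x - G x) * P + G x * (P - Q) by ring.
apply: pdvdD; first by apply: pdvdMr => //; apply/dFG/mem_head.
apply: pdvdMl; first exact/dG/mem_head.
by apply: IHr => i /sub_r; [apply: dF | apply: dG | apply: dFG].
Qed.

(** For nonzero [y], evaluate the factorization of ['X^N - 1] at [c / - y] and multiply by
    [(- y) ^+ N]. *)
Lemma prod_unity_roots (N : nat) (z c y : algC) : N.-primitive_root z ->
  \prod_(0 <= i < N) (c + z ^+ i * y) = c ^+ N - (- y) ^+ N.
Proof.
move=> zN; have N_gt0 := prim_order_gt0 zN.
have [->|y0] := eqVneq y 0.
  rewrite oppr0 expr0n gtn_eqF // subr0.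
  under eq_bigr do rewrite mulr0 addr0.
  by rewrite prodr_const_nat subn0.
have := congr1 (horner^~ (c / - y)) (factor_Xn_sub_1 zN).
rewrite horner_prod hornerD hornerXn hornerN hornerC.
move/(congr1 (fun u => (- y) ^+ N * u)).
have -> : (- y) ^+ N * ((c / - y) ^+ N - 1) = c ^+ N - (- y) ^+ N.
  by rewrite mulrBr mulr1 -exprMn mulrC divfK ?oppr_eq0.
move=> <-; rewrite -[X in (- y) ^+ X]subn0 -prodr_const_nat -big_split.
apply: eq_bigr => i _; rewrite /= hornerXsubC mulrBr [- y * (c / _)]mulrC.
by rewrite divfK ?oppr_eq0 //; ring.
Qed.

(** Coinciding sums are kept with multiplicity, so that a product over the list can be evaluated one
    variable at a time. *)
Fixpoint twists (z : algC) (N : nat) (ys : seq algC) : seq algC :=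
  if ys is y :: ys' then
    [seq z ^+ i * y + e | i <- index_iota 0 N, e <- twists z N ys']
  else [:: 0].

Lemma mem_twists (z : algC) (N : nat) (I : eqType) (r : seq I) (y : I -> algC) e :
  uniq r -> e \in twists z N (map y r) ->
  exists k : I -> nat, e = \sum_(i <- r) z ^+ k i * y i.
Proof.
elim: r e => [|x r IHr] e /=.
  by rewrite inE => _ /eqP->; exists (fun=> 0%N); rewrite big_nil.
case/andP=> xr ur /allpairsP[[j e'] /= [_ /(IHr _ ur)[k ->] ->]].
(* As [x] does not occur in [r], changing the exponent at [x] leaves the other terms alone. *)
exists (fun i => if i == x then j else k i); rewrite big_cons eqxx; congr (_ + _).
by apply: eq_big_seq => i ir; rewrite (negPf (memPn xr i ir)).
Qed.

Lemma pdvd_twists (p : nat) (z : algC) (N : nat) (ys : seq algC) :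
  pdvd p 0 z -> {in ys, forall y, pdvd p 0 y} ->
  {in twists z N ys, forall e, pdvd p 0 e}.
Proof.
move=> dz; elim: ys => [|y ys IHy] dys e /=.
  by rewrite inE => /eqP->; apply: pdvd_zero.
case/allpairsP=> -[i e'] /= [_ e'y ->]; apply: pdvdD.
  by apply: pdvdMl; [apply: pdvdX | apply/dys/mem_head].
by apply: IHy e'y => u uy; apply: dys; rewrite inE uy orbT.
Qed.

(* Replacing the multipliers [mu i], which are only approximate [N]-th roots of
   unity, by all the exact ones: in one variable the product over the roots of
   unity is [c^N - (-y)^N], which is congruent to [c^N - (-y mu)^N], a multiple
   of [c + y mu]. *)
Lemma prod_twists (p t : nat) (z : algC) (N : nat) (I : eqType) (r : seq I)
    (y mu : I -> algC) (c : algC) :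
  N.-primitive_root z -> pdvd p 0 c ->
  {in r, forall i,
    [/\ pdvd p 0 (y i), pdvd p 0 (mu i) & pdvd p t (mu i ^+ N - 1)]} ->
  pdvd p t (c + \sum_(i <- r) y i * mu i) ->
  pdvd p t (\prod_(e <- twists z N (map y r)) (c + e)).
Proof.
move=> zN dc; elim: r c dc => [|x r IHr] c dc dr.
  by rewrite /= big_nil big_seq1.
have dr' : {in r, forall i,
    [/\ pdvd p 0 (y i), pdvd p 0 (mu i) & pdvd p t (mu i ^+ N - 1)]}.
  by move=> i ir; apply: dr; rewrite inE ir orbT.
have [dy dmu dmuN] := dr x (mem_head _ _).
rewrite big_cons addrA => dsum; have dc' : pdvd p 0 (c + y x * mu x).
  by apply: pdvdD => //; apply: pdvdMl.
(* The first term of the sum is absorbed into the constant, which is why the induction runs over all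
   [c]. *)
have {IHr dsum} := IHr _ dc' dr' dsum.
have dtw : {in twists z N (map y r), forall e, pdvd p 0 e}.
  apply: pdvd_twists; last by move=> _ /mapP[i /dr'[di _ _] ->].
  exact/pdvd_Aint/(Aint_prim_root zN).
rewrite /= big_allpairs_dep exchange_big /=; move: (twists z N _) dtw => tw dtw dprod.
rewrite (eq_bigr (fun e => (c + e) ^+ N - (- y x) ^+ N)); last first.
  move=> e _; rewrite -(prod_unity_roots _ _ zN).
  by apply: eq_bigr => i _; ring.
have dsub : pdvd p t (\prod_(e <- tw) ((c + e) ^+ N - (- y x) ^+ N)
   - \prod_(e <- tw) ((c + e) ^+ N - (- (y x * mu x)) ^+ N)).
  apply: pdvd_prod_sub => e e_tw.
  - by apply: pdvdB; apply/pdvdX; [apply: pdvdD (dtw _ e_tw) | apply: pdvdN].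
  - apply: pdvdB; apply/pdvdX; [apply: pdvdD (dtw _ e_tw) => //|].
    exact/pdvdN/pdvdMl.
  rewrite -mulNr exprMn.
  set u := (c + e) ^+ N; set v := (- y x) ^+ N; set w := mu x ^+ N in dmuN *.
  have -> : u - v - (u - v * w) = v * (w - 1) by ring.
  by apply: pdvdMl => //; apply/pdvdX/pdvdN.
rewrite -[X in pdvd _ _ X]
  (subrK (\prod_(e <- tw) ((c + e) ^+ N - (- (y x * mu x)) ^+ N))).
apply: pdvdD => //; under eq_bigr do rewrite subrXX opprK addrAC.
rewrite big_split /=; apply: pdvdMr => //; rewrite big_seq; apply: pdvd_prod => e e_tw.
apply: pdvd_sum => i _; apply: pdvdMl; apply: pdvdX.
  by apply: pdvdD (dtw _ e_tw).
exact/pdvdN/pdvdMl.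
Qed.

(** * Congruences between exponents [n] and [a], and the twisted relation *)

Lemma pdvd_exprz (p : nat) (u : algC) (k : int) :
  pdvd p 0 u -> pdvd p 0 u^-1 -> pdvd p 0 (u ^ k).
Proof.
move=> du dV; case: k => k; first exact: pdvdX.
by rewrite NegzE -exprz_inv; apply: pdvdX.
Qed.

Lemma pdvd_sub1_exprz (p t : nat) (u : algC) (k : int) :
  u != 0 -> pdvd p 0 u -> pdvd p 0 u^-1 -> pdvd p t (u - 1) ->
  pdvd p t (u ^ k - 1).
Proof.
have sub1X v (j : nat) : pdvd p 0 v -> pdvd p t (v - 1) -> pdvd p t (v ^+ j - 1).
  move=> dv dv1; rewrite -[1 in X in pdvd _ _ X](expr1n _ j).
  by apply: pdvd_subX => //; apply: pdvd_one.
move=> u0 du dV du1; case: k => k; first exact: sub1X.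
rewrite NegzE -exprz_inv; apply: sub1X => //.
have -> : u^-1 - 1 = - (u - 1) * u^-1 by field.
by apply: pdvdMr => //; apply: pdvdN.
Qed.

Lemma pdvd_horner (p t : nat) (d : algC) (g : {poly algC}) (u v : algC) :
  {in (g : seq algC), forall b, d * b \in Aint} ->
  pdvd p 0 u -> pdvd p 0 v -> pdvd p t (u - v) ->
  pdvd p t (d * g.[u] - d * g.[v]).
Proof.
move=> dg du dv duv; rewrite !horner_coef !mulr_sumr -sumrB.
apply: pdvd_sum => i _; rewrite !mulrA -mulrBr; apply: pdvdMl.
  by apply/pdvd_Aint/dg/mem_nth.
exact: pdvd_subX.
Qed.

Lemma twisted_vanishing (p : nat) (q : {poly rat}) (s : nat)
    (lam : 'I_s -> algC) (f : 'I_s -> {poly algC}) (a : int) :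
  prime p -> (forall i, coprime p `|denq q`_i|) -> coprime p `|numq q`_0| ->
  q \is monic -> (forall i, root (map_poly ratr q) (lam i)) ->
  (forall t, exists2 n : int, (p%:Z ^+ t %| n - a)%Z &
     pdvd p t (\sum_(i < s) (f i).[n%:~R] * lam i ^ n)) ->
  exists xi : 'I_s -> algC, (forall i, is_root_of_unity (xi i)) /\
    \sum_(i < s) xi i * (f i).[a%:~R] * lam i ^ a = 0.
Proof.
move=> pr_p cop cq0 mq rq near_a.
have [N N_gt0 dN] := root_period pr_p cop cq0 mq.
have [z zN] := C_prim_root_exists N_gt0.
(* One [d] clears the denominators of all coefficients of all [f i]. Multiplying by it, instead of
   tracking a loss of powers of [p], keeps the modulus [p^t] unchanged. *)
have [d d_gt0 dF] :=
  algC_seq_denom (flatten [seq (f i : seq algC) | i <- enum 'I_s]).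
have df i : {in (f i : seq algC), forall b, d%:R * b \in Aint}.
  move=> b bf; apply: dF; apply/flattenP; exists (f i : seq algC) => //.
  by apply/mapP; exists i; rewrite ?mem_enum.
have dl i : pdvd p 0 (lam i) by apply: pdvd_root cop mq (rq i).
have lV i : lam i != 0 /\ pdvd p 0 (lam i)^-1.
  exact: pdvd_root_inv pr_p cop cq0 mq (rq i).
have dint (k : int) : pdvd p 0 k%:~R by apply/pdvd_Aint/Aint_int.
have dhorner i (k : int) : pdvd p 0 (d%:R * (f i).[k%:~R]).
  rewrite horner_coef mulr_sumr; apply: pdvd_sum => j _.
  by rewrite mulrA; apply: pdvdMl; [apply/pdvd_Aint/df/mem_nth | apply: pdvdX].
pose y i := d%:R * (f i).[a%:~R] * lam i ^ a.
have dy i : pdvd p 0 (y i).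
  by apply: pdvdMl => //; apply: pdvd_exprz => //; case: (lV i).
have /(pdvd_eq0 pr_p)/eqP : forall t,
    pdvd p t (\prod_(e <- twists z N (map y (enum 'I_s))) (0 + e)).
  move=> t; have [n /dvdzP[k nak] dUn] := near_a t.
  apply: (prod_twists (mu := fun i => lam i ^ (n - a)) zN (pdvd_zero _ _)).
    move=> i _; have [l0 dV] := lV i; split => //; first exact: pdvd_exprz.
    (* [lam i ^+ N] is congruent to 1 modulo [p], and the exponent [p ^ t] lifts this to modulo
       [p^t]. The integer [k] may be negative. *)
    have -> : (lam i ^ (n - a)) ^+ N = ((lam i ^+ N) ^+ (p ^ t)) ^ k.
      rewrite nak !exprnP !exprz_exp; congr (_ ^ _).
      have -> : (p ^ t)%N%:Z = p%:Z ^+ t by rewrite -!natz natrX.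
      ring.
    apply: pdvd_sub1_exprz; rewrite ?expf_neq0 -?exprVn //;
      try by do 2?apply: pdvdX.
    by apply: pdvd_sub_expp; [apply: pdvdX | apply: dN].
  rewrite add0r big_enum /=.
  (* The polynomial values at [a] are exchanged for those at [n], congruent modulo [p^t]; what
     remains is [d] times the Binet sum at [n]. *)
  have -> : \sum_(i < s) y i * lam i ^ (n - a) =
      \sum_(i < s) (d%:R * (f i).[a%:~R] - d%:R * (f i).[n%:~R]) * lam i ^ n
      + d%:R * \sum_(i < s) (f i).[n%:~R] * lam i ^ n.
    rewrite mulr_sumr -big_split; apply: eq_bigr => i _ /=.
    have [l0 _] := lV i; rewrite /y -mulrA -expfzDr // [a + _]addrC subrK; ring.
  apply: pdvdD; last by apply: pdvdMl => //; apply/pdvd_Aint/Aint_nat.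
  apply: pdvd_sum => i _; apply: pdvdMr; last first.
    by apply: pdvd_exprz => //; case: (lV i).
  apply: pdvd_horner => //; rewrite -rmorphB /= -opprB nak.
  rewrite rmorphN rmorphM rmorphXn /= -pmulrn; apply/pdvdN/pdvdMl => //.
  exact: pdvd_expn.
rewrite prodf_seq_eq0 => /hasP[e e_tw]; rewrite add0r => /eqP e0.
have [k] := mem_twists (enum_uniq _) e_tw; rewrite e0 big_enum /= => sum0.
exists (fun i => z ^+ k i); split=> [i|].
  exists N => //; apply/unity_rootP.
  by rewrite exprAC (prim_expr_order zN) expr1n.
have d0 : d%:R != 0 :> algC by rewrite pnatr_eq0 -lt0n.
apply: (mulfI d0); rewrite mulr0 [RHS]sum0 mulr_sumr; apply: eq_bigr => i _.
rewrite /y; ring.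
Qed.

(** * The Binet expansion *)

(** This is [(P(E) V)(n)], with [E] the shift operator. *)
Definition shift_act (F : fieldType) (P : {poly F}) (V : int -> F) (n : int) :
    F :=
  \sum_(i < size P) P`_i * V (n + (i : nat)%:Z).

Lemma shift_act_wide (F : fieldType) (P : {poly F}) (V : int -> F) (n : int) N :
  (size P <= N)%N -> shift_act P V n = \sum_(i < N) P`_i * V (n + (i : nat)%:Z).
Proof.
move=> sN; rewrite /shift_act (big_ord_widen _ (fun i => P`_i * V (n + i%:Z)) sN).
rewrite big_mkcond; apply: eq_bigr => i _; case: ltnP => // /(nth_default 0) ->.
by rewrite mul0r.
Qed.

Lemma eq_shift_act (F : fieldType) (P : {poly F}) (V W : int -> F) :
  V =1 W -> shift_act P V =1 shift_act P W.
Proof. by move=> eqVW n; apply: eq_bigr => i _; rewrite eqVW. Qed.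

Lemma shift_actD (F : fieldType) (P Q : {poly F}) (V : int -> F) n :
  shift_act (P + Q) V n = shift_act P V n + shift_act Q V n.
Proof.
set N := maxn (size P) (size Q).
rewrite !(@shift_act_wide _ _ _ _ N) ?leq_maxl ?leq_maxr ?size_polyD //.
by rewrite -big_split; apply: eq_bigr => i _; rewrite coefD mulrDl.
Qed.

Lemma shift_actZ (F : fieldType) (a : F) (P : {poly F}) (V : int -> F) n :
  shift_act (a *: P) V n = a * shift_act P V n.
Proof.
rewrite !(@shift_act_wide _ _ _ _ (size P)) ?size_scale_leq // mulr_sumr.
by apply: eq_bigr => i _; rewrite coefZ mulrA.
Qed.

Lemma shift_act_mulX (F : fieldType) (P : {poly F}) (V : int -> F) n :
  shift_act (P * 'X) V n = shift_act P V (n + 1).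
Proof.
rewrite (@shift_act_wide _ _ _ _ (size P).+1); last first.
  by apply: leq_trans (size_polyMleq _ _) _; rewrite size_polyX addn2.
rewrite big_ord_recl coefMX eqxx mul0r add0r; apply: eq_bigr => i _.
by rewrite coefMX /= -addrA.
Qed.

Lemma shift_act_sum (F : fieldType) (P : {poly F}) (I : Type) (r : seq I)
    (V : I -> int -> F) n :
  shift_act P (fun k => \sum_(i <- r) V i k) n = \sum_(i <- r) shift_act P (V i) n.
Proof. by rewrite exchange_big; apply: eq_bigr => i _; rewrite mulr_sumr. Qed.

Lemma shift_act_mulXsubC (F : fieldType) (P : {poly F}) (x : F) (V : int -> F) n :
  shift_act (P * ('X - x%:P)) V n = shift_act P (fun k => V (k + 1) - x * V k) n.
Proof.
rewrite mulrBr -mulrN -polyCN mulrC [_ * _%:P]mulrC mul_polyC [_ * P]mulrC.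
rewrite shift_actD shift_act_mulX shift_actZ mulr_sumr -big_split.
apply: eq_bigr => i _ /=; rewrite addrAC; ring.
Qed.

Lemma shift_act_mull (F : fieldType) (P Q : {poly F}) (V : int -> F) :
  (forall n, shift_act Q V n = 0) -> forall n, shift_act (P * Q) V n = 0.
Proof.
move=> QV0; elim/poly_ind: P => [|P c IHP] n.
  by rewrite mul0r /shift_act size_poly0 big_ord0.
rewrite mulrDl mulrAC mul_polyC shift_actD shift_act_mulX IHP.
by rewrite shift_actZ QV0 mulr0 addr0.
Qed.

Lemma coef_Xadd1_exp (F : fieldType) (k i : nat) :
  (('X + 1 : {poly F}) ^+ k)`_i = 'C(k, i)%:R.
Proof.
rewrite exprDn coef_sum; under eq_bigr do rewrite expr1n mulr1 coefMn coefXn.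
case: (ltnP i k.+1) => [ik|ki].
  have rik : (k - i < k.+1)%N by rewrite ltnS leq_subr.
  rewrite (bigD1 (Ordinal rik)) //= subKn // eqxx bin_sub // big1 ?addr0 // => j.
  rewrite -val_eqE /= => jk; case: eqP => [e|]; last by rewrite mul0rn.
  by move: jk; rewrite e subKn ?eqxx // -ltnS.
rewrite bin_small // big1 // => j _; case: eqP => [e|]; last by rewrite mul0rn.
by move: ki; rewrite e ltnNge leq_subr.
Qed.

Lemma size_diff_comp (F : fieldType) (g : {poly F}) (c : nat) :
  (size g <= c.+1)%N -> (size (g \Po ('X + 1) - g)%R <= c)%N.
Proof.
move=> sg; apply/leq_sizeP => j cj; rewrite coefB coef_comp_poly.
under eq_bigr do rewrite coef_Xadd1_exp.
case: (ltnP j (size g)) => jg; last first.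
  rewrite (nth_default _ jg) subr0 big1 // => i _; rewrite bin_small ?mulr0 //.
  exact: leq_trans (ltn_ord i) jg.
rewrite (bigD1 (Ordinal jg)) //= binn mulr1 big1 ?addr0 ?subrr // => i ij.
move: ij; rewrite -val_eqE /= => ij.
rewrite bin_small ?mulr0 // ltn_neqAle ij /=.
by apply: leq_trans cj; rewrite -ltnS; apply: leq_trans sg.
Qed.

(** The operator [E - x] replaces [g] by [x] times its forward difference, which lowers the degree;
    after [c] applications nothing is left. *)
Lemma shift_act_exp_poly (F : fieldType) (x : F) (g : {poly F}) (c : nat) :
  x != 0 -> (size g <= c)%N ->
  forall n, shift_act (('X - x%:P) ^+ c) (fun k => g.[k%:~R] * x ^ k) n = 0.
Proof.
move=> x0; elim: c g => [|c IHc] g sg n.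
  move: sg; rewrite leqn0 size_poly_eq0 => /eqP->; rewrite /shift_act big1 // => i _.
  by rewrite horner0 mul0r mulr0.
rewrite exprSr shift_act_mulXsubC.
rewrite -[RHS](IHc (x *: (g \Po ('X + 1) - g)) _ n); last first.
  by apply: leq_trans (size_scale_leq _ _) _; apply: size_diff_comp.
apply: eq_shift_act => k.
rewrite expfzDr // hornerZ hornerD hornerN horner_comp hornerD hornerX hornerC.
by rewrite rmorphD /= expr1z; ring.
Qed.

(** The leading term of [g] is removed by a monomial, and the rest by induction on the degree. The
    sigma type lets the solution be chosen as a function of [x]. *)
Lemma first_order_poly (F : fieldType) (x y : F) (g : {poly F}) :
  (forall n, n.+1%:R != 0 :> F) -> y != 0 ->
  {h : {poly F} | (size h <= size g + (x == y))%N &&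
                  (x *: (h \Po ('X + 1)) - y *: h == g)}.
Proof.
move=> char0 y0; have [m] := ubnP (size g); elim: m g => // m IHm g sg.
have [g0|gN0] := eqVneq g 0.
  by exists 0; rewrite size_poly0 comp_poly0 !scaler0 subr0 g0 eqxx.
pose n := (size g).-1; have sgn : size g = n.+1 by rewrite prednK ?size_poly_gt0.
pose k := (n + (x == y))%N.
(* On ['X^k] the operator has leading coefficient [x - y] in degree [k]. If [x = y] this cancels,
   and the next coefficient is [y * k] in degree [k - 1]; hence [k = n + 1] in that case. *)
pose a := lead_coef g / (if x == y then y * n.+1%:R else x - y).
pose h0 := a *: 'X^k.
pose T h := x *: (h \Po ('X + 1)) - y *: h.
have coefT i : (T h0)`_i = a * (x * 'C(k, i)%:R - y * (i == k)%:R).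
  rewrite /T /h0 comp_polyZ comp_Xn_poly coefB !coefZ coef_Xadd1_exp coefXn; ring.
have sg1 : (size (g - T h0)%R <= n)%N.
  apply/leq_sizeP => j; rewrite leq_eqVlt coefB coefT.
  rewrite /a /k lead_coefE -/n; case: (eqVneq x y) => [->|xy] /orP[/eqP<-|nj] /=.
  - rewrite addn1 binSn ltn_eqF // mulr0 subr0 divfK ?subrr //.
    by rewrite mulf_neq0.
  - rewrite (nth_default 0 (_ : size g <= j)%N) ?sgn // addn1.
    move: nj; rewrite leq_eqVlt => /orP[/eqP<-|nj]; first by rewrite binn eqxx /=; ring.
    by rewrite bin_small // gtn_eqF //=; ring.
  - by rewrite addn0 binn eqxx !mulr1 divfK ?subrr // subr_eq0.
  rewrite (nth_default 0 (_ : size g <= j)%N) ?sgn // addn0.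
  by rewrite bin_small // gtn_eqF //=; ring.
have nm : (n < m)%N by rewrite -ltnS -sgn.
have [h1 /andP[sh1 /eqP eh1]] := IHm _ (leq_ltn_trans sg1 nm).
exists (h0 + h1); apply/andP; split.
  apply: leq_trans (size_polyD _ _) _; rewrite geq_max sgn addSn; apply/andP; split.
    by apply: leq_trans (size_scale_leq _ _) _; rewrite size_polyXn.
  apply: leq_trans sh1 _; rewrite -addSn leq_add2r.
  exact: leq_trans sg1 _.
rewrite comp_polyD !scalerDr opprD addrACA eh1 /T; apply/eqP; ring.
Qed.

(** Expand [(E - y) V] by induction and solve for a preimage term by term. What remains of [V] is
    killed by [E - y], hence is a multiple of [y ^ n]. *)
Lemma binet_seq (F : fieldType) (L : seq F) (V : int -> F) :
  (forall n, n.+1%:R != 0 :> F) -> 0 \notin L ->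
  (forall n, shift_act (\prod_(x <- L) ('X - x%:P)) V n = 0) ->
  exists2 f : F -> {poly F}, forall x, (size (f x) <= count_mem x L)%N &
    forall n, V n = \sum_(x <- undup L) (f x).[n%:~R] * x ^ n.
Proof.
move=> char0; elim: L V => [|y L IHL] V L0 LV.
  exists (fun=> 0) => [x|n]; first by rewrite size_poly0.
  rewrite big_nil -(LV n) big_nil /shift_act size_poly1 big_ord1 coef1 mul1r.
  by rewrite addr0.
move: L0; rewrite inE eq_sym negb_or => /andP[y0 L0].
have [n|g sg gV] := IHL (fun k => V (k + 1) - y * V k) L0.
  by rewrite -shift_act_mulXsubC mulrC -(LV n) big_cons.
have h_ex x := @first_order_poly _ x y (g x) char0 y0.
pose h x := sval (h_ex x).
have sh x : (size (h x) <= size (g x) + (x == y))%N.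
  by rewrite /h; case: (h_ex x) => /= u /andP[].
have eh x : x *: (h x \Po ('X + 1)) - y *: h x = g x.
  by rewrite /h; case: (h_ex x) => /= u /andP[_ /eqP].
pose W n := V n - \sum_(x <- undup L) (h x).[n%:~R] * x ^ n.
have WS n : W (n + 1) = y * W n.
  apply/eqP; rewrite -subr_eq0; apply/eqP.
  transitivity ((V (n + 1) - y * V n)
      - \sum_(x <- undup L) (x *: (h x \Po ('X + 1)) - y *: h x).[n%:~R] * x ^ n).
    have -> : \sum_(x <- undup L) (x *: (h x \Po ('X + 1)) - y *: h x).[n%:~R] * x ^ n
      = \sum_(x <- undup L) (h x).[(n + 1)%:~R] * x ^ (n + 1)
        - y * \sum_(x <- undup L) (h x).[n%:~R] * x ^ n.
      rewrite mulr_sumr -sumrB; apply: eq_big_seq => x; rewrite mem_undup => xL.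
      have x0 : x != 0 by apply: contraNneq L0 => <-.
      rewrite expfzDr // hornerD hornerN !hornerZ horner_comp hornerD hornerX hornerC.
      by rewrite rmorphD /= expr1z; ring.
    by rewrite /W; ring.
  by rewrite gV -sumrB big1 // => x _; rewrite eh subrr.
have WE n : W n = W 0 * y ^ n.
  elim/int_rec: n => [|k IHk|k IHk]; first by rewrite expr0z mulr1.
    by rewrite -addn1 PoszD WS IHk expfzDr // expr1z; ring.
  apply: (mulfI y0); rewrite -WS.
  have -> : - k.+1%:Z + 1 = - k%:Z by rewrite -addn1 PoszD; ring.
  rewrite IHk mulrCA; congr (_ * _).
  have -> : - k%:Z = 1 + - k.+1%:Z by rewrite -addn1 PoszD; ring.
  by rewrite expfzDr // expr1z.
(* If [y] is not in [L], the sum subtracted in [W] has no term at [y], although the bound on [h y]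
   allows a nonzero constant; the test on [L] discards it. *)
exists (fun x => (if x \in L then h x else 0) + (if x == y then (W 0)%:P else 0)).
  move=> x; apply: leq_trans (size_polyD _ _) _; rewrite geq_max /= eq_sym.
  apply/andP; split; last first.
    by case: eqP; rewrite ?size_poly0 // (leq_trans (size_polyC_leq1 _)).
  case: ifP => _; last by rewrite size_poly0.
  by apply: leq_trans (sh x) _; rewrite addnC leq_add2l.
move=> n; rewrite -[LHS](subrK (\sum_(x <- undup L) (h x).[n%:~R] * x ^ n)) -/(W n).
rewrite [RHS](eq_bigr (fun x => (if x \in L then h x else 0).[n%:~R] * x ^ n
  + (if x == y then W 0 * x ^ n else 0))); last first.
  by move=> x _ /=; rewrite hornerD mulrDl; case: eqP; rewrite ?hornerC ?horner0 ?mul0r.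
rewrite big_split [LHS]addrC; congr (_ + _).
  rewrite /=; have [yL|yL] := boolP (y \in L); last first.
    rewrite big_cons (negPf yL) horner0 mul0r add0r.
    by apply: eq_big_seq => x; rewrite mem_undup => ->.
  by apply: eq_big_seq => x; rewrite mem_undup => ->.
rewrite -big_mkcond -big_filter (@filter_pred1_uniq _ (undup (y :: L))) ?undup_uniq //.
  by rewrite big_seq1 WE.
by rewrite mem_undup mem_head.
Qed.

(** Removing one [y] leaves every other [x] its full multiplicity, which suffices to kill the term
    at [x], and the term at [y] is zero. *)
Lemma shift_act_rem (F : fieldType) (L : seq F) (V : int -> F)
    (f : F -> {poly F}) (y : F) :
  0 \notin L -> (forall x, (size (f x) <= count_mem x L)%N) ->
  (forall n, V n = \sum_(x <- undup L) (f x).[n%:~R] * x ^ n) -> f y = 0 ->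
  forall n, shift_act (\prod_(x <- rem y L) ('X - x%:P)) V n = 0.
Proof.
move=> L0 sf Vf fy0 n; rewrite (eq_shift_act _ Vf) shift_act_sum.
rewrite big1_seq // => x /=; rewrite mem_undup => xL.
have x0 : x != 0 by apply: contraNneq L0 => <-.
have [->|xy] := eqVneq x y.
  by rewrite fy0 /shift_act big1 // => i _; rewrite horner0 mul0r mulr0.
rewrite (bigID (fun w => w == x)) /= mulrC; apply: shift_act_mull => k.
rewrite (eq_bigr (fun=> 'X - x%:P)); last by move=> w /eqP->.
rewrite big_const_seq iter_mulr_1; apply: shift_act_exp_poly => //.
by rewrite count_rem /= eq_sym (negPf xy) andbF subn0.
Qed.

(** * Minimality and the characteristic polynomial *)

(** A zero lowest coefficient is dropped by translating the relation by one, which is possible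
    because it holds on all integers. The list may shrink to [[::]], whose lowest coefficient is 1
    by default. *)
Lemma recurrence_strip (U : int -> rat) (c : seq rat) :
  (forall n : int,
    U (n + (size c)%:Z) = \sum_(i < size c) c`_i * U (n + (i : nat)%:Z)) ->
  exists2 c' : seq rat, (size c' <= size c)%N & recurrence U c'.
Proof.
elim: c => [|x c IHc] recU; first by exists [::] => //; split; rewrite ?oner_neq0.
have [x0|xN0] := eqVneq x 0; last by exists (x :: c).
have [|c' sc' rec'] := IHc; last by exists c' => //; apply: leqW.
move=> n; have := recU (n - 1); rewrite big_ord_recl /= x0 mul0r add0r.
have e (k : nat) : n - 1 + k.+1%:Z = n + k%:Z by rewrite -addn1 PoszD; ring.
by rewrite e => ->; apply: eq_bigr => i _; rewrite e.
Qed.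

(* A linear functional [phi] with [phi 1 = 1] turns a monic relation over an
   extension of [rat] into a rational one of the same order. *)
Lemma lrs_no_shorter (U : lrs) (L : fieldExtType rat) (P : {poly L}) :
  P \is monic -> (forall n, shift_act P (fun k => (U k)%:A) n = 0) ->
  (size (lrs_coefs U) < size P)%N.
Proof.
move=> mP PU; pose phi : L -> rat := coord [tuple (1 : L)] ord0.
have phi1 : phi 1 = 1.
  have free1 : free [tuple (1 : L)] by rewrite seq1_free oner_neq0.
  exact: (coord_free ord0 ord0 free1).
have phiM (x : L) (b : rat) : phi (x * b%:A) = b * phi x.
  by rewrite mulr_algr /phi linearZ.
set d := (size P).-1.
have sP : size P = d.+1 by rewrite prednK // size_poly_gt0 monic_neq0.
(* [phi] may kill the lowest coefficient even when that of [P] is nonzero, hence the call to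
   [recurrence_strip]. *)
pose c := mkseq (fun i => - phi P`_i) d.
have [|c' sc' rec'] := @recurrence_strip U c.
  move=> n; rewrite size_mkseq; move: (congr1 phi (PU n)).
  rewrite /shift_act sP {1 2}/phi linear_sum linear0.
  rewrite (eq_bigr (fun i : 'I_d.+1 => U (n + (i : nat)%:Z) * phi P`_i)); last first.
    by move=> i _; exact: phiM.
  rewrite big_ord_recr /= -[P`_d]/(lead_coef P) (monicP mP) phi1 mulr1.
  rewrite addrC => /eqP; rewrite addr_eq0 => /eqP->.
  rewrite -sumrN; apply: eq_bigr => i _.
  by rewrite nth_mkseq // mulNr mulrC.
case: (lrs_minimal U) => _ /(_ c' rec') sU.
by apply: leq_ltn_trans sU _; apply: leq_ltn_trans sc' _; rewrite size_mkseq sP.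
Qed.

Lemma char_poly_lrsE (U : lrs) (i : nat) :
  (char_poly_lrs U)`_i = (i == size (lrs_coefs U))%:R - (lrs_coefs U)`_i.
Proof. by rewrite coefB coefXn coef_Poly. Qed.

Lemma size_char_poly_lrs (U : lrs) :
  size (char_poly_lrs U) = (size (lrs_coefs U)).+1.
Proof.
by rewrite size_polyDl size_polyXn // size_polyN ltnS size_Poly.
Qed.

Lemma char_poly_lrs_monic (U : lrs) : char_poly_lrs U \is monic.
Proof.
rewrite monicE lead_coefE size_char_poly_lrs char_poly_lrsE eqxx.
by rewrite nth_default ?subr0.
Qed.

Lemma char_poly_lrs0 (U : lrs) : `|numq (char_poly_lrs U)`_0|%N =
  `|numq (lowest_coef (lrs_coefs U))|%N.
Proof.
rewrite char_poly_lrsE; case: (lrs_coefs U) => [|x c] /=; first by [].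
by rewrite sub0r numqN abszN.
Qed.

Lemma char_poly_lrs_act (U : lrs) n : shift_act (char_poly_lrs U) U n = 0.
Proof.
rewrite /shift_act size_char_poly_lrs big_ord_recr /= char_poly_lrsE eqxx.
rewrite nth_default // subr0 mul1r.
have [[_ recU] _] := lrs_minimal U.
rewrite recU -big_split big1 //= => i _.
by rewrite char_poly_lrsE ltn_eqF // sub0r mulNr addNr.
Qed.

(** Each adjoined generator contributes polynomials over the previous field. As [S] is a bare
    predicate, its ring operations are first derived from subtraction and division. *)
Lemma adjoin_mem_closed (L : fieldExtType rat) (iota : {rmorphism L -> algC})
    (S : {pred algC}) (l : seq L) :
  GRing.divring_closed S -> {in l, forall x, iota x \in S} ->
  {in <<1 & l>>%VS, forall v, iota v \in S}.
Proof.
move=> [S1 SB SV]; have S0 : 0 \in S by rewrite -(subrr 1) SB.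
have SN x : x \in S -> - x \in S by move=> Sx; rewrite -sub0r SB.
have SD x y : x \in S -> y \in S -> x + y \in S.
  by move=> Sx Sy; rewrite -[y]opprK SB ?SN.
have SM x y : x \in S -> y \in S -> x * y \in S.
  by move=> Sx Sy; rewrite -[y]invrK SV // -[y^-1]mul1r SV.
have Snat (n : nat) : n%:R \in S by elim: n => // n IHn; rewrite -addn1 natrD SD.
have Sint (k : int) : k%:~R \in S.
  by case: k => k; [exact: Snat | rewrite NegzE mulrNz SN //; exact: Snat].
have Srat (x : rat) : ratr x \in S by apply: SV.
have SX x n : x \in S -> x ^+ n \in S.
  by move=> Sx; elim: n => // n IHn; rewrite exprS SM.
elim/last_ind: l => [|l x IHl] Sl v.
  rewrite Fadjoin_nil => /vlineP[c ->]; by rewrite rmorphZ_num rmorph1 mulr1.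
rewrite adjoin_rcons => /Fadjoin_polyP[q /polyOverP ql ->].
have Sx : iota x \in S by apply: Sl; rewrite mem_rcons mem_head.
rewrite -horner_map horner_coef.
elim/big_ind: _ => // i _; rewrite coef_map SM ?SX //.
by apply: IHl (ql _) => y yl; apply: Sl; rewrite mem_rcons inE yl orbT.
Qed.

Lemma binet_exists (U : lrs) :
  exists (s : nat) (lam : 'I_s -> algC) (f : 'I_s -> {poly algC}),
    binet_expansion U lam f.
Proof.
set chi := char_poly_lrs U; have mchi := char_poly_lrs_monic U.
have [r] := closed_field_poly_normal (map_poly ratr chi : {poly algC}).
have /monicP-> : map_poly ratr chi \is @monic algC by rewrite map_monic.
rewrite scale1r => chi_r.
(* Working in the number field generated by the roots puts the coefficients of the [f i] in the
   required field, and provides the finite extension on which [lrs_no_shorter] relies. *)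
have [L [iota [l lr genL]]] := num_field_exists r.
have iotaA (x : rat) : iota x%:A = ratr x.
  by rewrite rmorphZ_num rmorph1 mulr1.
have chi_l : map_poly (in_alg L) chi = \prod_(x <- l) ('X - x%:P).
  apply: (map_poly_inj iota); rewrite -map_poly_comp.
  rewrite (eq_map_poly (iotaA : _ =1 ratr)) chi_r rmorph_prod -lr big_map.
  by apply: eq_bigr => x _; rewrite /= map_polyXsubC.
have l0 : 0 \notin l.
  have [[c0 _] _] := lrs_minimal U; apply: contra c0.
  rewrite -root_prod_XsubC -chi_l rootE horner_coef0 coef_map fmorph_eq0.
  by rewrite -!numq_eq0 -!absz_eq0 char_poly_lrs0.
have char0 n : n.+1%:R != 0 :> L.
  by rewrite -(fmorph_eq0 iota) rmorph_nat pnatr_eq0.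
have Ul n : shift_act (\prod_(x <- l) ('X - x%:P)) (fun k => (U k)%:A) n = 0.
  rewrite -chi_l /shift_act size_map_poly.
  transitivity ((shift_act chi U n)%:A : L); last by rewrite char_poly_lrs_act scale0r.
  rewrite /shift_act scaler_suml; apply: eq_bigr => i _.
  by rewrite coef_map /= mulr_algr scalerA mulrC.
have [f sf Uf] := binet_seq char0 l0 Ul.
pose s := size (undup l); pose lam0 (i : 'I_s) : L := (undup l)`_i.
have lam0_mem i : lam0 i \in l by rewrite -mem_undup mem_nth.
exists s, (fun i => iota (lam0 i)), (fun i => map_poly iota (f (lam0 i))).
split.
- move=> i j /fmorph_inj/eqP; rewrite nth_uniq ?undup_uniq // => /eqP.
  exact: val_inj.
- move=> x; rewrite chi_r root_prod_XsubC -lr; split.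
    case/mapP=> y; rewrite -mem_undup => yl ->.
    have iy : (index y (undup l) < s)%N by rewrite index_mem.
    by exists (Ordinal iy); rewrite /lam0 /= nth_index.
  by case=> i <-; apply: map_f.
- move=> i; rewrite map_poly_eq0; apply/eqP => fi0.
  (* Dropping one root would give a monic relation of degree one less than the minimal order. *)
  have := lrs_no_shorter (monic_prod_XsubC _ _ _) (shift_act_rem l0 sf Uf fi0).
  rewrite size_prod_XsubC size_rem // => lt_m.
  have := congr1 (fun P : {poly L} => size P) chi_l.
  rewrite size_map_poly size_prod_XsubC size_char_poly_lrs => -[e].
  have l_gt0 : (0 < size l)%N by case: (l) (lam0_mem i).
  by move: lt_m; rewrite prednK // -e ltnn.
- move=> i k S cS Slam; rewrite coef_map; apply: (adjoin_mem_closed cS (l := l)).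
    move=> y; rewrite -mem_undup => yl.
    have iy : (index y (undup l) < s)%N by rewrite index_mem.
    by have := Slam (Ordinal iy); rewrite /lam0 /= nth_index.
  by rewrite genL memvf.
move=> n; rewrite -iotaA Uf rmorph_sum (big_nth 0) big_mkord; apply: eq_bigr => i _.
by rewrite rmorphM fmorphXz /= -horner_map rmorph_int.
Qed.

(** * From valuations to divisibility, and the conclusion *)

Lemma padic_val_pdvd (p t : nat) (x : rat) :
  prime p -> (t%:Z%:E <= padic_val p x)%E -> pdvd p t (ratr x).
Proof.
move=> pr_p; rewrite /padic_val; case: eqP => [->|/eqP x0].
  by rewrite rmorph0 => _; apply: pdvd_zero.
rewrite lee_fin => le_t.
have nx0 : (0 < `|numq x|)%N by rewrite absz_gt0 numq_eq0.
have dx0 : (0 < `|denq x|)%N by rewrite absz_gt0 denq_neq0.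
(* In lowest terms, a denominator divisible by [p] would make the valuation negative, while [t] is a
   natural number. *)
have p_den : ~~ (p %| `|denq x|)%N.
  apply/negP => pd; have pn : ~~ (p %| `|numq x|)%N.
    apply/negP => pn; have := coprime_num_den x; rewrite /coprime => /eqP g1.
    have := dvdn_gcd p `|numq x| `|denq x|; rewrite g1 pn pd dvdn1 => /eqP p1.
    by move: pr_p; rewrite p1.
  move: le_t; rewrite (@logn_coprime _ `|numq x|) ?prime_coprime // sub0r.
  have : (0 < logn p `|denq x|)%N by rewrite logn_gt0 mem_primes pr_p dx0.
  by case: (logn _ _).
have ld0 : logn p `|denq x| = 0%N by rewrite logn_coprime ?prime_coprime.
move: le_t; rewrite ld0 subr0 lez_nat => le_t.
by apply: pdvd_rat; rewrite ?prime_coprime // pfactor_dvdn.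
Qed.

Unset Implicit Arguments.

Theorem theorem1p4 (U : lrs) (a : int) (p : nat) (hp : regular_prime U p)
    (h : exists n : nat -> int,
      tends_to_pinfty (fun k => padic_val p (U (n k))) /\
      tends_to_pinfty (fun k => padic_val p (n k - a)%:~R)) :
  twisted_zero U a.
Proof.
have [pr_p den_c num_c0] := hp; have [n [Un na]] := h.
have [s [lam [f binet]]] := binet_exists U.
exists s, lam, f; split=> //; have [_ rootE _ _ Uf] := binet.
apply: (@twisted_vanishing p (char_poly_lrs U)) => //.
(* The coefficients are those of the recurrence with opposite sign, then the leading 1, then
   zeros. *)
- move=> i; rewrite prime_coprime // char_poly_lrsE.
  have [ic|ci] := ltnP i (size (lrs_coefs U)); last first.
    rewrite [X in _ - X]nth_default // subr0.
    by case: eqP; rewrite dvdn1 gtn_eqF ?prime_gt1.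
  by rewrite ltn_eqF // sub0r denqN; apply/den_c/mem_nth.
- by rewrite prime_coprime // char_poly_lrs0.
- exact: char_poly_lrs_monic.
- by move=> i; apply/rootE; exists i.
move=> t; have [K1 hK1] := Un t; have [K2 hK2] := na t.
pose k := maxn K1 K2; exists (n k).
  have /(pdvd_numq pr_p) := padic_val_pdvd pr_p (hK2 k (leq_maxr _ _)).
  by rewrite numq_int dvdzE abszX.
rewrite -Uf; apply: padic_val_pdvd => //; exact: hK1 k (leq_maxl _ _).
Qed.
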